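(* Let $T=m_1^{e_1}m_2^{e_2}\cdots m_r^{e_r}\cdot 2^t$, where $m_1,\dots,m_r$ are distinct odd primes, $e_1,\dots,e_r$ are positive integers and $t\ge 0$ is an integer. For each odd prime $m$ let $g(m)$ denote the number of irreducible polynomials in $\mathbb{Z}_2[x]$ whose period equals $m$. Then there are at least $(2^t-1)(2^{tr}-2^{(t-1)r})\prod_{i=1}^r g(m_i)+2^{tr}\prod_{i=1}^r g(m_i)$ distinct polynomials $f\in\mathbb{Z}_2[x]$ with $f(0)\ne0$, having $x+1$ as a factor, whose period equals $T$.
   Context: For $f\in\mathbb{Z}_2[x]$ with $f(0)\ne0$, the period $p(f)$ is the least positive integer $e$ such that $f(x)$ divides $x^e-1$. *)

(* Defs.v *)
From mathcomp Require Import all_boot all_order all_algebra finmap.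
From mathcomp Require Import boolp classical_sets functions cardinality.

Set Implicit Arguments.
Unset Strict Implicit.
Unset Printing Implicit Defensive.

Import GRing.Theory.

Local Open Scope classical_set_scope.
Local Open Scope ring_scope.

Lemma period_exists (f : {poly 'F_2}) :
  f.[0] != 0 -> exists e : nat, (0 < e)%N && (f %| 'X^e - 1).
Proof.
move=> f0; have fn0 : f != 0 by apply: contraNneq f0 => ->; rewrite horner0.
have size_mod (i : nat) : ('X^i %% f) \is a poly_of_size (size f).
  by rewrite qualifE/= ltnW // ltn_modp.
pose h (i : 'I_(#|{poly_(size f) 'F_2}|.+1)) := NPoly (size_mod i).
have /injectivePn[i [j neq_ij /(congr1 val)/= eq_h]] : ~~ injectiveb h.
  by apply/injectiveP => /leq_card; rewrite card_ord ltnn.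
wlog lt_ij : i j neq_ij eq_h / (i < j)%N.
  move=> H; have /orP[lt|lt] : (i < j)%N || (j < i)%N.
  - by rewrite -neq_ltn.
  - exact: H lt.
  - by apply: H lt; rewrite 1?eq_sym.
exists (j - i)%N; rewrite subn_gt0 lt_ij /=.
have copX : coprimep f 'X^i.
  by rewrite coprimep_expr // -['X]subr0 -polyC0 coprimep_XsubC.
rewrite -(Gauss_dvdpl _ copX) mulrBl mul1r -exprD subnK; last exact: ltnW.
by rewrite /dvdp modpD modpN eq_h subrr.
Qed.

(* Junk value 0 when f(0) = 0, in which case no e as in the specification
   periodP exists. *)
Definition period (f : {poly 'F_2}) : nat :=
  match f.[0] != 0 =P true with
  | ReflectT f0 => ex_minn (period_exists f0)
  | ReflectF _ => 0
  end.

Lemma periodP (f : {poly 'F_2}) : f.[0] != 0 ->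
  [/\ (0 < period f)%N, f %| 'X^(period f) - 1 &
      forall e : nat, (0 < e)%N -> f %| 'X^e - 1 -> (period f <= e)%N].
Proof.
move=> f0; rewrite /period; case: eqP => // f0'.
case: ex_minnP => e /andP[e0 fe] emin; split=> // k k0 fk.
by apply: emin; rewrite k0 fk.
Qed.

Definition irr_of_period (m : nat) : set {poly 'F_2} :=
  [set f | irreducible_poly f /\ f.[0] != 0 /\ period f = m].

(* fset_set is only meaningful on finite sets. *)
Lemma finite_irr_of_period (m : nat) : finite_set (irr_of_period m).
Proof.
apply: (@sub_finite_set _ _ [set val g | g in [set: {poly_(m.+1) 'F_2}]]).
  move=> f [_ [f0 fm]]; have [m0 fdvd _] := periodP f0.
  have szf : f \is a poly_of_size m.+1.
    rewrite qualifE/= -(@size_XnsubC 'F_2 m 1) -fm //.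
    by rewrite polyC1 dvdp_leq // -size_poly_eq0 -polyC1 size_XnsubC.
  by exists (NPoly szf).
exact/finite_image/finite_finset.
Qed.

Definition g (m : nat) : nat := #|` fset_set (irr_of_period m)|.

(* Main.v *)
(* Take f = (x+1)^a h_1^{b_1} ... h_r^{b_r} with h_i irreducible of period
   m_i^{e_i} and exponents in [1, 2^t], at least one of them exceeding 2^(t-1).
   If h is irreducible and e = 2^k u with u odd, then x^e - 1 =
   (x^u - 1)^(2^k) with x^u - 1 squarefree, so h^b divides x^e - 1 iff the
   period of h divides e and b <= 2^k; hence f has period T.

   There are at least g(m) irreducible polynomials of period m^e: if h is
   irreducible of period m, every irreducible factor of h(x^(m^(e-1))) has
   period m^e, because h is coprime to x - 1, and different h give coprime
   h(x^(m^(e-1))). *)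
Require Import Defs.
From mathcomp Require Import all_boot all_order all_algebra all_field finmap ring.
From mathcomp Require Import boolp classical_sets cardinality.

Set Implicit Arguments.
Unset Strict Implicit.
Unset Printing Implicit Defensive.

Import GRing.Theory Num.Theory.
Local Open Scope ring_scope.

(** * Irreducible polynomials over the field with two elements *)

Lemma eqp_F2 (p q : {poly 'F_2}) : p %= q -> p = q.
Proof.
have lead1 (u : {poly 'F_2}) : u != 0 -> lead_coef u = 1.
  by rewrite -lead_coef_eq0; case: (lead_coef u) => -[|[|]] // *; apply/val_inj.
have [->|p0] := eqVneq p 0; first by rewrite eqp_sym eqp0 => /eqP.
have [->|q0 /eqp_eq] := eqVneq q 0; first by rewrite eqp0 => /eqP.
by rewrite !lead1 // !scale1r.
Qed.

Lemma dvdp_irr_eq (p q : {poly 'F_2}) :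
  irreducible_poly p -> irreducible_poly q -> p %| q -> p = q.
Proof.
by move=> [p1 _] [_ qP] /qP H; apply/eqp_F2/H; rewrite neq_ltn p1 orbT.
Qed.

Lemma irr_coprime (p q : {poly 'F_2}) :
  irreducible_poly p -> irreducible_poly q -> p != q -> coprimep p q.
Proof.
move=> pP qP; rewrite irreducible_poly_coprime //.
by apply: contra_neqN; apply: dvdp_irr_eq.
Qed.

Lemma irr_factor (F : fieldType) (p : {poly F}) :
  (1 < size p)%N -> exists2 q, irreducible_poly q & q %| p.
Proof.
have [n] := ubnP (size p); elim: n p => // n IH p /ltnSE le_n p1.
have [pP|pP] := EM (irreducible_poly p); first by exists p.
have [q [q1 qp nq]] : exists q : {poly F}, [/\ size q != 1, q %| p & ~~ (q %= p)].
  apply: contra_notP pP => nq; split=> // q q1 qp.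
  by apply/negPn/negP => H; apply: nq; exists q.
have p0 : p != 0 by rewrite -size_poly_gt0 ltnW.
have q0 : q != 0 by apply: contraNneq p0 => q0; move: qp; rewrite q0 dvd0p.
have lt_qp : (size q < size p)%N.
  by rewrite ltn_neqAle dvdp_leq // dvdp_size_eqp // nq.
have [||u uP uq] := IH q; first exact: leq_trans le_n.
- by rewrite ltn_neqAle eq_sym q1 size_poly_gt0.
- by exists u => //; apply: dvdp_trans qp.
Qed.

(** * Divisors of ['X^e - 1] and the period *)

Lemma dvdp_Xn_sub1_horner0 (F : fieldType) (f : {poly F}) (e : nat) :
  (0 < e)%N -> f %| 'X^e - 1 -> f.[0] != 0.
Proof.
move=> e0 /dvdpP[q /(congr1 (horner^~ 0))].
rewrite !hornerE expr0n -[e == 0]negbK -lt0n e0 sub0r => qf.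
by apply: contraTneq (oner_neq0 F) => f0; rewrite -oppr_eq0 qf f0 mulr0 eqxx.
Qed.

Lemma dvdp_Xn_sub1 (f : {poly 'F_2}) (e : nat) :
  f.[0] != 0 -> (f %| 'X^e - 1) = (period f %| e)%N.
Proof.
move=> f0; have [p0 fp pmin] := periodP f0.
have fdvd (a : nat) : f %| 'X^(a * period f) - 1.
  apply: dvdp_trans fp _; rewrite mulnC exprM -(expr1n _ a) subrXX.
  by rewrite expr1n dvdp_mulIl.
apply/idP/idP => [fe|/dvdnP[a ->]]; last exact: fdvd.
rewrite /dvdn eqn0Ngt; apply/negP => r0.
have := pmin _ r0; rewrite leqNgt ltn_mod p0 => H.
apply/negP/H : isT; rewrite /is_true -/(is_true _).
(* With e = a p + r, where p is the period, X^e - 1 = (X^(a p) - 1) X^r + (X^r - 1), so f would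
   divide X^r - 1 with 0 < r < p. *)
move: fe; rewrite {1}(divn_eq e (period f)) exprD.
rewrite -[X in X - 1](subrK ('X^(e %% period f))) -addrA.
by rewrite -{2}['X^(e %% _)]mul1r -mulrBl dvdp_addr // dvdp_mulr.
Qed.

(** Iterated Frobenius: raising to the power p is additive in characteristic p and fixes 1. *)
Lemma subr1_exp_pchar (R : comNzRingType) (p : nat) (x : R) (k : nat) :
  p \in [pchar R] -> x ^+ (p ^ k) - 1 = (x - 1) ^+ (p ^ k).
Proof.
move=> pR; elim: k => [|k IH]; first by rewrite expn0 !expr1.
rewrite expnSr !exprM -IH -!(pFrobenius_autE pR).
by rewrite pFrobenius_autB_comm ?pFrobenius_aut1 //; apply: commr1.
Qed.

Lemma Xn_sub1_exp2 (e k : nat) :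
  'X^(e * 2 ^ k) - 1 = ('X^e - 1) ^+ (2 ^ k) :> {poly 'F_2}.
Proof. by rewrite exprM subr1_exp_pchar // pchar_poly pchar_Fp. Qed.

Lemma dvdp_exp_Xn_sub1 (h : {poly 'F_2}) (b e : nat) :
  irreducible_poly h -> h.[0] != 0 -> (0 < b)%N -> (0 < e)%N ->
  h ^+ b %| 'X^e - 1 -> (period h %| e)%N && (b <= 2 ^ logn 2 e)%N.
Proof.
move=> hP h0 b0 e0 hbe.
have he : h %| 'X^e - 1 by apply: dvdp_trans hbe; rewrite dvdp_exp.
rewrite -dvdp_Xn_sub1 // he /=; move: he hbe.
have [u cop eq_e] := pfactor_coprime (isT : prime 2) e0.
rewrite {1 2}eq_e Xn_sub1_exp2; set k := (2 ^ _)%N => hk hb.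
(* An irreducible divisor of a power divides its base. *)
have hu : h %| 'X^u - 1.
  apply: contraTT hk; rewrite -!irreducible_poly_coprime //.
  exact: coprimep_expr.
have [q eq_q] := dvdpP _ _ hu.
(* Since u is odd, it is nonzero in the field, so ['X^u - 1] is separable and h occurs in it only
   once. Its exponent in the 2^k-th power is then exactly 2^k. *)
have copq : coprimep h q.
  rewrite coprimep_sym; apply: (@separable_coprime _ ('X^u - 1)); last first.
    by rewrite eq_q.
  apply: separable_Xn_sub_1.
  by rewrite -(dvdn_pcharf (pchar_Fp (isT : prime 2))) -prime_coprime.
move: hb; rewrite eq_q exprMn Gauss_dvdpr; last first.
  exact/coprimep_expl/coprimep_expr.
by rewrite dvdp_Pexp2l //; case: hP.
Qed.

(** * Products of powers of distinct irreducibles and their period *)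

Section IrrProd.

Variables (I : finType) (p : I -> {poly 'F_2}) (n : I -> nat).
Hypotheses (p_irr : forall i, irreducible_poly (p i)) (p_inj : injective p).

Let f := \prod_i p i ^+ n i.

Lemma irr_prod_coprime (J : pred I) (i : I) :
  ~~ J i -> coprimep (p i) (\prod_(j | J j) p j ^+ n j).
Proof.
move=> iJ; elim/big_rec: _ => [|j x jJ cop]; first exact: coprimep1.
rewrite coprimepMr cop andbT; apply/coprimep_expr/irr_coprime => //.
by apply: contraNneq iJ => /p_inj ->.
Qed.

Lemma exp_dvdp_irr_prod (i : I) (k : nat) : (p i ^+ k %| f) = (k <= n i)%N.
Proof.
rewrite /f (bigD1 i) //= Gauss_dvdpl; last first.
  by apply/coprimep_expl/irr_prod_coprime; rewrite eqxx.
by rewrite dvdp_Pexp2l //; case: (p_irr i).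
Qed.

Lemma irr_dvdp_irr_prod (h : {poly 'F_2}) :
  irreducible_poly h -> h %| f -> exists i, h = p i.
Proof.
move=> hP; apply: contraPP => nh; apply/negP.
rewrite -irreducible_poly_coprime //; rewrite /f.
elim/big_rec: _ => [|j x _ cop]; first exact: coprimep1.
rewrite coprimepMr cop andbT; apply/coprimep_expr/irr_coprime => //.
by apply/eqP => hj; apply: nh; exists j.
Qed.

Lemma irr_prod_dvdp (q : {poly 'F_2}) :
  (forall i, p i ^+ n i %| q) -> f %| q.
Proof.
move=> dvd_q; rewrite /f -big_enum /=.
elim: (enum I) (enum_uniq I) => [|i s IH /= /andP[is_notin uniq_s]].
  by rewrite big_nil dvd1p.
rewrite big_cons Gauss_dvdp ?dvd_q ?IH //; apply: coprimep_expl.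
by rewrite big_uniq //; apply: (@irr_prod_coprime (mem s)).
Qed.

(** The condition on [N] characterises it as the lcm of the periods, through its multiples. The
    bound [2 ^ t < 2 * n i] is n_i > 2^(t-1) in a form that also makes sense at t = 0. *)
Lemma period_irr_prod (N t : nat) :
  (forall i, (p i).[0] != 0) -> (forall i, 0 < n i <= 2 ^ t)%N ->
  (exists i, 2 ^ t < 2 * n i)%N -> odd N ->
  (forall e, (N %| e)%N <-> forall i, (period (p i) %| e)%N) ->
  f.[0] != 0 /\ period f = (N * 2 ^ t)%N.
Proof.
move=> p0 n_bnd [i0 n_i0] oddN NP.
have N0 : (0 < N)%N by case: N oddN {NP}.
have T0 : (0 < N * 2 ^ t)%N by rewrite muln_gt0 N0 expn_gt0.
have fT : f %| 'X^(N * 2 ^ t) - 1.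
  apply: irr_prod_dvdp => i; have /andP[_ le_n] := n_bnd i.
  rewrite Xn_sub1_exp2; apply: dvdp_trans (dvdp_exp2l _ le_n) _.
  by apply: dvdp_exp2r; rewrite dvdp_Xn_sub1 //; move: i {le_n}; apply/NP.
have f0 := dvdp_Xn_sub1_horner0 T0 fT; split=> //.
have [q0 fq qmin] := periodP f0.
apply/eqP; rewrite eqn_dvd -dvdp_Xn_sub1 // fT /=.
have pq (i : I) : (period (p i) %| period f)%N && (n i <= 2 ^ logn 2 (period f))%N.
  apply: dvdp_exp_Xn_sub1 => //; first by have /andP[] := n_bnd i.
  by apply: dvdp_trans fq; rewrite exp_dvdp_irr_prod.
rewrite Gauss_dvd ?coprimeXr ?coprimen2 //.
apply/andP; split; first by apply/NP => i; have /andP[] := pq i.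
(* If 2^l is the exact power of 2 in the period, the large exponent gives 2^t < 2 n_i0 <= 2^(l+1),
   hence t <= l. *)
rewrite pfactor_dvdn // -ltnS -(ltn_exp2l _ _ (isT : 1 < 2)%N).
apply: leq_trans n_i0 _; rewrite expnS leq_mul2l /=.
by have /andP[] := pq i0.
Qed.

End IrrProd.

(** * Irreducible polynomials of prime power period *)

Lemma irr_lift (m e : nat) (f : {poly 'F_2}) :
  prime m -> (0 < e)%N -> irr_of_period m f ->
  exists2 h, irr_of_period (m ^ e) h & h %| f \Po 'X^(m ^ e.-1).
Proof.
move=> m_pr e0 [fP [f0 fm]]; set k := (m ^ e.-1)%N.
have k0 : (0 < k)%N by rewrite expn_gt0 prime_gt0.
have mk : (m * k)%N = (m ^ e)%N by rewrite -expnS prednK.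
have f1 : (1 < size f)%N by case: fP.
have Xk_comp (a : nat) : ('X^a - 1) \Po 'X^k = 'X^(a * k) - 1 :> {poly 'F_2}.
  by rewrite comp_polyB comp_Xn_poly comp_polyC -exprM mulnC.
have [|h hP hf] := @irr_factor _ (f \Po 'X^k).
  rewrite -subn_gt0 subn1 size_comp_poly size_polyXn muln_gt0 /= k0 andbT.
  by rewrite -subn1 subn_gt0.
have h_dvd : h %| 'X^(m ^ e) - 1.
  apply: dvdp_trans hf _; rewrite -mk -Xk_comp; apply: dvdp_comp_poly.
  by rewrite dvdp_Xn_sub1 // fm.
have h0 : h.[0] != 0.
  apply: (dvdp_Xn_sub1_horner0 _ h_dvd); by rewrite expn_gt0 prime_gt0.
exists h => //; split=> //; split=> //.
(* As its period m exceeds 1, f is coprime to X - 1, and substituting X^k preserves coprimality. *)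
have cop : coprimep (f \Po 'X^k) ('X^k - 1).
  have <- : ('X^1 - 1) \Po 'X^k = 'X^k - 1 :> {poly 'F_2} by rewrite Xk_comp mul1n.
  apply: coprimep_comp_poly; rewrite irreducible_poly_coprime //.
  by rewrite dvdp_Xn_sub1 // fm dvdn1 gtn_eqF ?prime_gt1.
have : ~~ (h %| 'X^k - 1).
  rewrite -irreducible_poly_coprime //; exact: coprimep_dvdr hf cop.
rewrite dvdp_Xn_sub1 //; move: h_dvd; rewrite dvdp_Xn_sub1 //.
(* The period of h is some m^j with j <= e; it does not divide m^(e-1), so j = e. *)
move=> /(dvdn_pfactor _ _ m_pr)[j le_j ->].
rewrite dvdn_Pexp2l ?prime_gt1 // -ltnNge => lt_j.
by congr (m ^ _)%N; apply/eqP; rewrite eqn_leq le_j -(prednK e0).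
Qed.

Lemma irr_of_period_exp (m e : nat) : prime m -> (0 < e)%N ->
  exists s : seq {poly 'F_2},
    [/\ uniq s, size s = g m & forall h, h \in s -> irr_of_period (m ^ e) h].
Proof.
move=> m_pr e0; set k := (m ^ e.-1)%N.
(* [l] picks one lift of each f; off the irreducibles of period m its value is irrelevant. *)
have /choice[l lP] (f : {poly 'F_2}) : exists h, irr_of_period m f ->
    irr_of_period (m ^ e) h /\ h %| f \Po 'X^k.
  have [fP|nfP] := EM (irr_of_period m f); last by exists 0.
  by have [h] := irr_lift m_pr e0 fP; exists h.
set S := fset_set (irr_of_period m).
have SP f : f \in (S : seq _) -> irr_of_period m f.
  by move=> fS; apply/set_mem; rewrite -in_fset_set //; apply: finite_irr_of_period.
exists (map l S); split; last 2 first.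
- by rewrite size_map.
- by move=> h /mapP[f /SP /lP[]? _ ->].
rewrite map_inj_in_uniq ?fset_uniq // => f f' /SP fP /SP f'P eq_l.
apply/eqP/negPn/negP => neq.
have [[hP _] hf] := lP _ fP; have [_] := lP _ f'P; rewrite -eq_l => hf'.
(* A common lift of f and f' would divide two coprime polynomials. *)
have := coprimep_comp_poly 'X^k (irr_coprime fP.1 f'P.1 neq).
by move=> /(coprimep_dvdr hf); rewrite irreducible_poly_coprime ?hf'.
Qed.

(** * Arithmetic and counting of exponent vectors *)

Lemma dvdn_prod_prime_exp (I : finType) (m e : I -> nat) (a : nat) :
  injective m -> (forall i, prime (m i)) ->
  (\prod_i m i ^ e i %| a)%N <-> forall i, (m i ^ e i %| a)%N.
Proof.
move=> m_inj m_pr; split=> [H i|H].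
  by apply: dvdn_trans H; rewrite (bigD1 i) //= dvdn_mulr.
apply/unstable.Gauss_dvd_prod => [|i _ _]; last exact: H.
rewrite filter_predT pairwise_map.
have := index_enum_uniq I; rewrite uniq_pairwise; apply: sub_pairwise => i j /= nij.
rewrite coprimeXl // coprimeXr // prime_coprime // dvdn_prime2 //.
by apply: contraNneq nij => /m_inj ->.
Qed.

(** The complement consists of the vectors with every entry below [M./2]. An ordinal k encodes the
    exponent k + 1, so for M = 2^t with t > 0 the condition [M./2 <= k] means an exponent above
    2^(t-1). *)
Lemma card_some_ge_half (I : finType) (M : nat) :
  (#|[pred ab : 'I_M * {ffun I -> 'I_M} |
       (M./2 <= ab.1) || [exists i, M./2 <= ab.2 i]]|
   + M./2 * M./2 ^ #|I| = M * M ^ #|I|)%N.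
Proof.
set A := [pred ab | _]; pose K := [pred x : 'I_M | (x < M./2)%N].
have cK : #|K| = M./2.
  have le_half : (M./2 <= M)%N.
    by rewrite -{2}(odd_double_half M) -addnn addnA leq_addl.
  by rewrite -sum1_card (big_ord_narrow le_half) sum1_card card_ord.
have <- : #|[predC A]| = (M./2 * M./2 ^ #|I|)%N.
  rewrite -{1}cK -{1}cK -card_ffun_on -cardX; apply: eq_card => -[a b].
  rewrite !inE negb_or -ltnNge negb_exists; congr (_ && _).
  by apply/forallP/ffun_onP => H i; have := H i; rewrite !inE -ltnNge.
by rewrite cardC card_prod card_ffun card_ord.
Qed.

(* At t = 0 the power 2 ^ ((t - 1) r) may be fractional, but its coefficient
   2 ^ t - 1 vanishes. *)
Lemma count_lower_bound (t r G a : nat) (M := (2 ^ t)%N) :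
  (a + M./2 * M./2 ^ r = M * M ^ r)%N ->
  ((2 : rat) ^+ t - 1)
      * ((2 : rat) ^+ (t * r) - (2 : rat) ^ ((t%:Z - 1) * r%:Z)) * G%:R
    + (2 : rat) ^+ (t * r) * G%:R <= (G * a)%:R.
Proof.
rewrite /M; case: t {M} => [|s].
  rewrite mul0n !expr0 subrr !mul0r add0r mul1r.
  by rewrite mul0n addn0 expn0 exp1n muln1 => ->; rewrite muln1.
have -> : (2 ^ s.+1)./2 = (2 ^ s)%N by rewrite expnS mul2n doubleK.
move=> /(congr1 (GRing.natmul (1 : rat))).
rewrite natrD !natrM !natrX => /(canRL (addrK _)) ->.
have -> : (s.+1%:Z - 1) * r%:Z = (s * r)%N.
  by rewrite -addn1 PoszD addrK -PoszM.
rewrite -exprnP !exprM; set A := (2 ^+ s.+1) ^+ r; set B := (2 ^+ s) ^+ r.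
rewrite exprS; set x := 2 ^+ s; rewrite -subr_ge0.
(* Here x = 2^(t-1); the count exceeds the claimed bound by exactly G B (x - 1), which is
   nonnegative as x >= 1. *)
have -> : G%:R * (2 * x * A - x * B) - ((2 * x - 1) * (A - B) * G%:R + A * G%:R)
          = G%:R * B * (x - 1) by ring.
by rewrite !mulr_ge0 // ?exprn_ge0 // subr_ge0 exprn_ege1.
Qed.

(** * The family of polynomials and its size *)

Theorem theorem13 (r t T : nat) (m e : 'I_r -> nat) :
  injective m ->
  (forall i, prime (m i) && odd (m i)) ->
  (forall i, (0 < e i)%N) ->
  T = ((\prod_(i < r) m i ^ e i) * 2 ^ t)%N ->
  exists s : seq {poly 'F_2},
    [/\ uniq s,
        forall f, f \in s -> [/\ f.[0] != 0, 'X + 1 %| f & period f = T] &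
        ((2 : rat) ^+ t - 1)
            * ((2 : rat) ^+ (t * r) - (2 : rat) ^ ((t%:Z - 1) * r%:Z))
            * (\prod_(i < r) g (m i))%N%:R
          + (2 : rat) ^+ (t * r) * (\prod_(i < r) g (m i))%N%:R
        <= (size s)%:R].
Proof.
move=> m_inj m_odd_pr e0 ->; set N := (\prod_(i < r) _)%N; set M := (2 ^ t)%N.
have m_pr i : prime (m i) by have /andP[] := m_odd_pr i.
have /choice[L LP] i := irr_of_period_exp (m_pr i) (e0 i).
(* [C] chooses one irreducible per prime and [E] the exponents less one. The index [None] stands for
   the factor x + 1, of period 1, and [w] gives the period of each factor. *)
pose C := {dffun forall i : 'I_r, 'I_(size (L i))}.
pose E := ('I_M * {ffun 'I_r -> 'I_M})%type.
pose p (c : C) (o : option 'I_r) := if o is Some i then (L i)`_(c i) else 'X + 1.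
pose n (ab : E) (o : option 'I_r) := (if o is Some i then ab.2 i else ab.1).+1.
pose w (o : option 'I_r) := if o is Some i then (m i ^ e i)%N else 1%N.
have w_inj : injective w.
  have w_gt1 i : (1 < m i ^ e i)%N.
    by rewrite -(expn0 (m i)) ltn_exp2l ?prime_gt1.
  move=> [i|] [j|] //= => [eq_w|eq_w|eq_w].
  - have : (m i %| m j ^ e j)%N by rewrite -eq_w dvdn_exp.
    by rewrite Euclid_dvdX // dvdn_prime2 // => /andP[/eqP/m_inj ->].
  - by have := w_gt1 i; rewrite eq_w.
  - by have := w_gt1 j; rewrite -eq_w.
have pP c o : irr_of_period (w o) (p c o).
  case: o => [i|] /=; first by have [_ _] := LP i; apply; apply: mem_nth.
  have X10 : ('X + 1 : {poly 'F_2}).[0] != 0 by rewrite !hornerE oner_eq0.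
  split; first by rewrite -polyC1; apply: irredp_XaddC.
  split=> //; apply/eqP; rewrite -dvdn1 -dvdp_Xn_sub1 // expr1 -polyC1 -polyCN.
  (* In characteristic 2, x + 1 is x - 1, hence its period is 1. *)
  by rewrite (_ : -1 = 1) //; apply/val_inj.
have p_irr c o : irreducible_poly (p c o) by case: (pP c o).
have p_inj c : injective (p c).
  by move=> o o' /(congr1 period); rewrite (pP c o).2.2 (pP c o').2.2 => /w_inj.
pose F (x : C * E) := \prod_o p x.1 o ^+ n x.2 o.
have F_inj : injective F.
  move=> x y eqF.
  (* A factor of [F x] is also some factor of [F y]; its period determines the index, because [w] is
     injective. *)
  have eqp o : p x.1 o = p y.1 o.
    have : p x.1 o %| F x.
      by rewrite -[p x.1 o]expr1 (exp_dvdp_irr_prod _ (p_irr _) (@p_inj _)).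
    rewrite eqF => /(irr_dvdp_irr_prod (p_irr _) (p_irr _ _))[o' eqo].
    rewrite eqo; congr p; apply/w_inj.
    by rewrite -(pP x.1 o).2.2 eqo (pP y.1 o').2.2.
  (* Each exponent is the largest power of its factor dividing the common product, so both
     inequalities follow. *)
  have eqn o : n x.2 o = n y.2 o.
    apply/eqP; rewrite eqn_leq.
    rewrite -(exp_dvdp_irr_prod _ (p_irr y.1) (@p_inj _)) -eqp -[\prod_i _]eqF.
    rewrite (exp_dvdp_irr_prod _ (p_irr x.1) (@p_inj _)) leqnn /=.
    rewrite -(exp_dvdp_irr_prod _ (p_irr x.1) (@p_inj _)) -[\prod_i _]/(F x) eqF eqp.
    by rewrite (exp_dvdp_irr_prod _ (p_irr y.1) (@p_inj _)).
  case: x y eqF eqp eqn => [c [a b]] [c' [a' b']] /= _ eqp eqn.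
  congr (_, (_, _)).
  - apply/ffunP => i; apply/val_inj/eqP; have [uL _ _] := LP i.
    rewrite -(nth_uniq 0 _ _ uL) ?ltn_ord //; apply/eqP; exact: (eqp (Some i)).
  - by apply/val_inj; case: (eqn None).
  - by apply/ffunP => i; apply/val_inj; case: (eqn (Some i)).
pose A := [pred ab : E | (M./2 <= ab.1) || [exists i, M./2 <= ab.2 i]]%N.
exists [seq F x | x in [predX predT & A]]; split.
- by rewrite map_inj_uniq ?enum_uniq.
- move=> f /mapP[[c ab]]; rewrite mem_enum inE /= => abA ->.
  have [| | | | |F0 FT] := @period_irr_prod _ (p c) (n ab) (p_irr c) (@p_inj c) N t.
  + by move=> o; case: (pP c o) => _ [].
  + by case=> [i|] /=; apply: ltn_ord.
  (* The shift from ordinal to exponent turns the weak bound into a strict one; at t = 0, [M./2] is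
     0 and nothing is excluded. *)
  + have halfP (x : nat) : (M./2 <= x)%N -> (M < 2 * x.+1)%N.
      by rewrite leq_half_double mul2n doubleS.
    by case/orP: abA => [/halfP|/existsP[i /halfP]]; [exists None | exists (Some i)].
  + rewrite /N; elim/big_rec: _ => // i x _ oddx; rewrite oddM oddX oddx andbT.
    by have /andP[_ ->] := m_odd_pr i; rewrite orbT.
  + move=> a; rewrite dvdn_prod_prime_exp //; split=> [H [i|]|H i].
    * by rewrite (pP c (Some i)).2.2; apply: H.
    * by rewrite (pP c None).2.2; apply: dvd1n.
    * by have := H (Some i); rewrite (pP c (Some i)).2.2.
  + split=> //; rewrite -['X + 1]/(p c None) -[p c None]expr1.
    by rewrite (exp_dvdp_irr_prod (n ab) (p_irr c) (@p_inj c)).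
have cC : #|C| = (\prod_(i < r) g (m i))%N.
  rewrite card_dep_ffun foldrE big_map big_enum; apply: eq_bigr => i _.
  by rewrite card_ord; case: (LP i).
rewrite size_image cardX [#|predT|]cC; apply: count_lower_bound.
by have := card_some_ge_half 'I_r M; rewrite card_ord.
Qed.
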